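(* Let $t>s\geq 6$ be integers, let $G$ be a graph on $t$ vertices, and let $H=\overline{K}_s\vee G$, with $S$ the set of $s$ vertices inducing $\overline{K}_s$. If $\Delta(G)\leq 2$, then $H$ is $S$-Roth.
   Context: Graphs are finite and simple. $\overline{K}_s$ is the edgeless graph on $s$ vertices, $\Delta(G)$ is the maximum degree of $G$, and $G_1\vee G_2$ is the join (disjoint union of $G_1$ and $G_2$ plus all edges between $V(G_1)$ and $V(G_2)$). For a graph $H$ with adjacency matrix $A(H)$ and diagonal degree matrix $D(H)$, the signless Laplacian is $Q(H)=D(H)+A(H)$, and $\mu(H)$ denotes its smallest eigenvalue. Eigenvectors are real. For a vector $x$ indexed by $V(H)$ and nonempty $U\subseteq V(H)$, $x(U)$ is the subvector of entries indexed by $U$; $v>0$ (resp. $v<0$) means all entries of $v$ are strictly positive (resp. negative). Definition: let $H$ be a connected graph and $S\subseteq V(H)$ a maximal (under inclusion) independent set. $H$ is $S$-Roth if for every eigenvector $x$ of $Q(H)$ corresponding to $\mu(H)$, either $x(S)>0$ and $x(V(H)\setminus S)<0$, or $x(S)<0$ and $x(V(H)\setminus S)>0$. *)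

(* Defs.v *)
From HB Require Import structures.
From mathcomp Require Import all_boot all_order all_algebra.
From mathcomp Require Import reals.

Set Implicit Arguments.
Unset Strict Implicit.
Unset Printing Implicit Defensive.

Import Order.TTheory GRing.Theory Num.Theory.

Local Open Scope ring_scope.

Record sgraph := SGraph {
  vertex :> finType;
  adj : rel vertex;
  adj_sym : symmetric adj;
  adj_irrefl : irreflexive adj }.

Arguments adj {s} _ _.

Definition degree (H : sgraph) (v : H) : nat := #|[set w : H | adj v w]|.

Definition max_degree (H : sgraph) : nat := \max_(v : H) degree v.

Definition connected_graph (H : sgraph) : Prop :=
  (0 < #|H|)%N /\ forall v w : H, connect (@adj H) v w.

Definition independent (H : sgraph) (S : {set H}) : bool :=
  [forall v in S, forall w in S, ~~ adj v w].

Definition maximal_independent (H : sgraph) (S : {set H}) : bool :=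
  maxset (@independent H) S.

Section Edgeless.
Variable s : nat.

Definition edgeless_adj : rel 'I_s := fun _ _ => false.

Fact edgeless_sym : symmetric edgeless_adj. Proof. by []. Qed.
Fact edgeless_irrefl : irreflexive edgeless_adj. Proof. by []. Qed.

Definition edgeless : sgraph := SGraph edgeless_sym edgeless_irrefl.
End Edgeless.

Section Join.
Variables G1 G2 : sgraph.

Definition join_adj : rel (G1 + G2)%type := fun u v =>
  match u, v with
  | inl a, inl b => adj a b
  | inr a, inr b => adj a b
  | _, _ => true
  end.

Fact join_sym : symmetric join_adj.
Proof. by move=> [a|a] [b|b] //=; rewrite adj_sym. Qed.

Fact join_irrefl : irreflexive join_adj.
Proof. by move=> [a|a] /=; rewrite adj_irrefl. Qed.

Definition join : sgraph := SGraph join_sym join_irrefl.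

Definition join_left : {set join} := [set inl v | v : G1].
End Join.

(* Matrices and vectors on V(H) are indexed by 'I_#|H| through
   enum_val / enum_rank. *)
Section SignlessLaplacian.
Variables (R : realType) (H : sgraph).

Definition adjacency_mx : 'M[R]_#|H| :=
  \matrix_(i, j) (adj (enum_val i) (enum_val j))%:R.

Definition degree_mx : 'M[R]_#|H| :=
  diag_mx (\row_i (degree (enum_val i))%:R).

Definition signless_laplacian : 'M[R]_#|H| := degree_mx + adjacency_mx.

Definition entry (x : 'rV[R]_#|H|) (v : H) : R := x 0 (enum_rank v).

Definition subvector_pos (x : 'rV[R]_#|H|) (U : {set H}) : Prop :=
  forall v, v \in U -> 0 < entry x v.

Definition subvector_neg (x : 'rV[R]_#|H|) (U : {set H}) : Prop :=
  forall v, v \in U -> entry x v < 0.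
End SignlessLaplacian.

Definition smallest_eigenvalue (R : realType) (n : nat) (M : 'M[R]_n)
    (mu : R) : Prop :=
  eigenvalue M mu /\ forall a : R, eigenvalue M a -> mu <= a.

(* Row vectors, as in [eigenvalue]; the signless Laplacian is symmetric, so
   left and right eigenvectors are transposes of each other. *)
Definition eigenvector (R : realType) (n : nat) (M : 'M[R]_n) (mu : R)
    (x : 'rV[R]_n) : Prop :=
  x != 0 /\ x *m M = mu *: x.

Definition S_Roth (R : realType) (H : sgraph) (S : {set H}) : Prop :=
  [/\ connected_graph H,
      maximal_independent S
    & forall (mu : R) (x : 'rV[R]_#|H|),
        smallest_eigenvalue (signless_laplacian R H) mu ->
        eigenvector (signless_laplacian R H) mu x ->
        (subvector_pos x S /\ subvector_neg x (~: S)) \/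
        (subvector_neg x S /\ subvector_pos x (~: S))].

(* Main.v *)
Require Import Defs.
From mathcomp Require Import all_boot all_order all_algebra.
From mathcomp Require Import reals.
From mathcomp Require Import complex spectral sesquilinear ring lra.

(** Write [H] for the join, [t] for the order of [G], [mu] for the smallest
    eigenvalue of [Q(H)], and let [x] be an eigenvector for [mu], with values
    [a] on [S] and [b] on [G], of sums [A] and [B].  The equation for [mu] reads
      [(t - mu) a_i = - B] at a vertex of [S], and
      [(s - mu + d_v) b_v + \sum_(w ~ v) b_w = - A] at a vertex of [G].
    When [mu < s <= t] the first line makes [a] constant and gives [A] and [B]
    opposite signs, so, replacing [x] by [- x] if needed, [A <= 0].  What has to
    be shown is that the solution [b] of
      [(c + d_v) b_v + \sum_(w ~ v) b_w = k], where [c = s - mu] and [k = - A],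
    is positive when [k > 0] and nonnegative when [k = 0]; in the latter case
    [B = 0], so [b = 0] and [x = 0], which is excluded.

    Positivity is a maximum principle ([shifted_solution_sign]).  Suppose that
    the minimum [m] of [b] is not positive.  The equation at a vertex of
    positive degree bounds [b] there from above in terms of [m], and the
    equation at a minimizing vertex, fed with that bound at its neighbours,
    then bounds [m] from below by a nonnegative multiple of [k].  This works as
    soon as [c] exceeds the maximum degree minus one, hence for maximum degree
    two as soon as [mu < s - 1].

    That last inequality ([smallest_eigenvalue_join_lt]) comes from the Rayleigh
    quotient of a vector constant on [S] and on [G].  That [mu] is a lower bound
    for Rayleigh quotients ([smallest_eigenvalue_rayleigh]) is read off the
    unitary diagonalization of the symmetric matrix over the complex numbers. *)

Set Implicit Arguments.
Unset Strict Implicit.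
Unset Printing Implicit Defensive.

Import Order.TTheory GRing.Theory Num.Theory.

Local Open Scope ring_scope.

(** * Rayleigh quotients of real symmetric matrices *)

Section Rayleigh.
Variable R : realType.
Local Open Scope sesquilinear_scope.

Local Notation toC := (real_complex R).

Lemma conj_real_mx m n (A : 'M[R]_(m, n)) :
  map_mx Num.conj (map_mx toC A) = map_mx toC A.
Proof. by rewrite realmxC //; apply/mxOverP => i j; rewrite mxE complex_real. Qed.

(** Diagonalizing [M] over the complex numbers as [P^* D P] with [P] unitary,
    both sides become sums over the coordinates of [z = y P^*]: the form is
    [\sum_i D_i |z_i|^2], the squared norm is [\sum_i |z_i|^2], and each [D_i],
    being real and an eigenvalue of [M], is at least [mu]. *)
Lemma smallest_eigenvalue_rayleigh n (M : 'M[R]_n) (mu : R) (y : 'rV[R]_n) :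
  M^T = M -> smallest_eigenvalue M mu ->
  mu * (y *m y^T) 0 0 <= (y *m M *m y^T) 0 0.
Proof.
move=> symM [_ min_mu].
set A := map_mx toC M; set y' := map_mx toC y.
have hermA : A \is hermsymmx.
  apply/is_hermitianmxP; rewrite expr0 scale1r.
  by rewrite /A map_trmx symM conj_real_mx.
have /orthomx_spectralP := hermitian_normalmx hermA.
have realD := hermitian_spectral_diag_real hermA.
have unitP := spectral_unitarymx A.
set P := spectralmx A in unitP *; set D := spectral_diag A in realD *.
rewrite (invmx_unitary unitP) => defA.
have PPt : P *m P ^t* = 1%:M by apply/unitarymxP.
have PtP : P ^t* *m P = 1%:M.
  by rewrite -(invmx_unitary unitP) mulVmx // unitarymx_unit.
have mu_le i : toC mu <= D 0 i.
  have /mxOverP/(_ 0 i) /complex_realP [r Dr] := realD.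
  (* [D 0 i] is the image of the real number [r]; the characteristic polynomial
     carries eigenvalues of [A] back to eigenvalues of [M]. *)
  rewrite Dr lecR; apply: min_mu.
  rewrite eigenvalue_root_char -(fmorph_root toC) map_char_poly.
  rewrite -eigenvalue_root_char; apply/eigenvalueP; exists (row i P).
    rewrite -row_mul -/A defA !mulmxA PPt mul1mx.
    by apply/rowP => j; rewrite mul_diag_mx !mxE Dr.
  apply: contraTneq (oner_neq0 R[i]) => P0.
  have : (row i P *m P ^t*) 0 i = 1 by rewrite -row_mul PPt !mxE eqxx.
  by rewrite P0 mul0mx mxE => <-; rewrite eqxx.
have ytE : map_mx toC y^T = y' ^t* by rewrite /y' map_trmx conj_real_mx.
pose z := y' *m P ^t*.
have zt : z ^t* = P *m y' ^t* by rewrite trmx_mul map_mxM trmxCK.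
have norm_y : toC ((y *m y^T) 0 0) = \sum_i `|z 0 i| ^+ 2.
  have -> : toC ((y *m y^T) 0 0) = (z *m z ^t*) 0 0.
    rewrite zt mulmxA -(mulmxA y') PtP mulmx1 -ytE -map_mxM.
    by rewrite [RHS]mxE.
  by rewrite mxE; apply: eq_bigr => i _; rewrite !mxE normCK.
have form_y : toC ((y *m M *m y^T) 0 0) = \sum_i D 0 i * `|z 0 i| ^+ 2.
  have -> : toC ((y *m M *m y^T) 0 0) = (z *m diag_mx D *m z ^t*) 0 0.
    rewrite zt mulmxA -(mulmxA y') -(mulmxA y') -defA -ytE -!map_mxM.
    by rewrite [RHS]mxE.
  rewrite mxE; apply: eq_bigr => i _.
  by rewrite mul_mx_diag !mxE normCK mulrAC mulrC.
rewrite -lecR rmorphM /= norm_y form_y mulr_sumr; apply: ler_sum => i _.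
by rewrite ler_wpM2r // exprn_ge0.
Qed.

End Rayleigh.

(** * The signless Laplacian in terms of vertices *)

Section SignlessLaplacianTheory.
Variables (R : realType) (H : sgraph).
Implicit Types x y : 'rV[R]_#|H|.

Lemma signless_laplacian_sym :
  (signless_laplacian R H)^T = signless_laplacian R H.
Proof.
rewrite /signless_laplacian linearD /= tr_diag_mx; congr (_ + _).
by apply/matrixP => i j; rewrite !mxE adj_sym.
Qed.

Lemma entry_signless_laplacian x v :
  entry (x *m signless_laplacian R H) v =
  (degree v)%:R * entry x v + \sum_(w : H | adj v w) entry x w.
Proof.
rewrite /entry mulmxDr mxE mul_mx_diag !mxE enum_rankK mulrC; congr (_ + _).
rewrite (reindex enum_rank) /=; last exact/onW_bij/enum_rank_bij.
rewrite [RHS]big_mkcond; apply: eq_bigr => w _.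
rewrite !mxE !enum_rankK adj_sym.
by case: (adj v w); rewrite ?mulr1 ?mulr0.
Qed.

Lemma dot_entry x y :
  (x *m y^T) 0 0 = \sum_(v : H) entry x v * entry y v.
Proof.
rewrite mxE (reindex enum_rank) /=; last exact/onW_bij/enum_rank_bij.
by apply: eq_bigr => v _; rewrite mxE.
Qed.

Definition vector_of (g : H -> R) : 'rV[R]_#|H| := \row_i g (enum_val i).

Lemma entry_vector_of g v : entry (vector_of g) v = g v.
Proof. by rewrite /entry mxE enum_rankK. Qed.

Lemma entry_inj x : (forall v, entry x v = 0) -> x = 0.
Proof.
move=> x0; apply/rowP => i; rewrite mxE -(x0 (enum_val i)).
by rewrite /entry enum_valK.
Qed.

Lemma sum_adj_cst (v : H) (a : R) : \sum_(w : H | adj v w) a = (degree v)%:R * a.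
Proof.
by rewrite sumr_const mulr_natl; congr (_ *+ _); apply: eq_card => w; rewrite inE.
Qed.

Lemma degree_le_max (v : H) : (degree v <= max_degree H)%N.
Proof. exact: leq_bigmax. Qed.

End SignlessLaplacianTheory.

(** * A maximum principle for a shifted signless Laplacian *)

Section ShiftedSystem.
Variables (R : realType) (G : sgraph) (c k : R) (b : G -> R).
Hypothesis c_gt : (max_degree G)%:R < c + 1.
Hypothesis c_gt0 : 0 < c.
Hypothesis k_ge0 : 0 <= k.
Hypothesis system : forall v,
  (c + (degree v)%:R) * b v + \sum_(w : G | adj v w) b w = k.

(** Let [m <= 0] be the minimum of [b], reached at [u] of degree [d], and let
    [D] be the maximum degree.  At a vertex [w] with a neighbour, of degree
    [e], the equation gives [(c + e) b_w <= k - e m], hence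
    [(c + 1) b_w <= k - D m].  Applied to the neighbours of [u], this turns the
    equation at [u] into
      [k (c + 1 - d) <= m (c (c + 1) + d (c + 1 - D))],
    where both factors in parentheses are positive since [d <= D < c + 1];
    so [m = k = 0]. *)
Lemma shifted_solution_sign v : 0 < b v \/ k = 0 /\ b v = 0.
Proof.
case: (arg_minP b (erefl : xpredT v)) => u _ min_u.
set m := b u; set D := (max_degree G)%:R : R.
have D_ge0 : 0 <= D by apply: ler0n.
have deg_le (w : G) : (degree w)%:R <= D by rewrite ler_nat degree_le_max.
have [m_gt0|m_le0] := ltrP 0 m.
  by left; apply: lt_le_trans m_gt0 _; apply: min_u.
have upper w : (c + 1) * b w <= k - D * m \/ degree w = 0%N.
  case Ew: (degree w) => [|d]; [by right | left].
  (* Passing from [c + e] to [c + 1] is legitimate only for [b w >= 0]; a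
     negative value satisfies the bound because [k - D * m >= 0]. *)
  have [bw_ge0|bw_lt0] := lerP 0 (b w); last first.
    have Dm_le0 : D * m <= 0 by apply: mulr_ge0_le0.
    have /ltW/le_trans-> // : (c + 1) * b w < 0.
      by rewrite pmulr_rlt0 // addr_gt0.
    by rewrite subr_ge0 (le_trans Dm_le0).
  have : \sum_(w' : G | adj w w') m <= \sum_(w' : G | adj w w') b w'.
    by apply: ler_sum => w' _; apply: min_u.
  have := system w; have := deg_le w; rewrite sum_adj_cst Ew.
  have : (1 : R) <= d.+1%:R by rewrite ler1n.
  set e := d.+1%:R : R; set S := \sum_(w' : G | _) _ => e1 eD eqS leS.
  have : 0 <= (e - 1) * b w by rewrite mulr_ge0 // subr_ge0.
  have : (D - e) * m <= 0 by rewrite mulr_ge0_le0 // subr_ge0.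
  by move=> *; lra.
have : (c + 1) * \sum_(w : G | adj u w) b w <= (degree u)%:R * (k - D * m).
  rewrite -sum_adj_cst mulr_sumr; apply: ler_sum => w uw.
  have [//|/eqP] := upper w; rewrite /degree cards_eq0 => /eqP/setP/(_ u).
  by rewrite !inE adj_sym uw.
have := system u; have := deg_le u; rewrite -/m.
have : 0 <= (degree u)%:R :> R by apply: ler0n.
set d := (degree u)%:R : R; set S := \sum_(w : G | _) _ => d0 dD eqS leS.
have key : k * (c + 1 - d) <= m * (c * (c + 1) + d * (c + 1 - D)).
  have : (c + 1) * ((c + d) * m + S) = (c + 1) * k by rewrite eqS.
  by move=> *; lra.
have pos : 0 < c * (c + 1) + d * (c + 1 - D).
  by rewrite ltr_pwDl ?mulr_gt0 ?mulr_ge0 ?subr_ge0 ?(ltW c_gt) // addr_gt0.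
have cd : 0 < c + 1 - d by rewrite subr_gt0 (le_lt_trans dD).
have k0 : k = 0 by apply/eqP; rewrite eq_le k_ge0 andbT; nra.
have m0 : m = 0 by apply/eqP; rewrite eq_le m_le0 /=; move: key; rewrite k0; nra.
have := min_u v erefl; rewrite -/m m0 le_eqVlt => /orP[/eqP<-|]; first by right.
by left.
Qed.

End ShiftedSystem.

(** * The join of an edgeless graph with a graph *)

Section EdgelessJoin.
Variables (R : realType) (s : nat) (G : sgraph).
Local Notation H := (join (edgeless s) G).
Local Notation Q := (signless_laplacian R H).

Lemma sum_join (F : H -> R) (P : pred H) :
  \sum_(v : H | P v) F v =
  \sum_(i : edgeless s | P (inl i)) F (inl i) + \sum_(v : G | P (inr v)) F (inr v).
Proof. exact: big_sumType. Qed.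

Lemma degreeE (T : sgraph) (v : T) : (degree v)%:R = \sum_(w : T | adj v w) 1 :> R.
Proof. by rewrite sum_adj_cst mulr1. Qed.

Lemma degree_join_left (i : edgeless s) : (degree (inl i : H))%:R = #|G|%:R :> R.
Proof. by rewrite degreeE sum_join /= big_pred0 // add0r sumr_const. Qed.

Lemma degree_join_right (v : G) :
  (degree (inr v : H))%:R = s%:R + (degree v)%:R :> R.
Proof. by rewrite !degreeE sum_join /= sumr_const card_ord. Qed.

Lemma entry_join_left x (i : edgeless s) :
  entry (x *m Q) (inl i : H) =
  #|G|%:R * entry x (inl i : H) + \sum_(v : G) entry x (inr v : H).
Proof.
by rewrite entry_signless_laplacian degree_join_left sum_join /= big_pred0 // add0r.
Qed.

Lemma entry_join_right x (v : G) :
  entry (x *m Q) (inr v : H) =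
  (s%:R + (degree v)%:R) * entry x (inr v : H) +
  (\sum_(i : edgeless s) entry x (inl i : H) +
   \sum_(w : G | adj v w) entry x (inr w : H)).
Proof. by rewrite entry_signless_laplacian degree_join_right sum_join. Qed.

(** If [G] were 2-regular, the vectors constant on [S] and on [G] would form an
    invariant plane.  On it, for a fixed value on [G], the form of
    [Q(H) - (s - 1)] is least when the values on [S] and on [G] are in the
    ratio of [- t] to [t - s + 1].  For this vector the form of [Q(H)] lies
    below [s - 1] times the squared norm by at least
    [t (s (s - 1) (t - s + 1) + (s - 5) (t - s + 1)^2)], which is positive for
    [s >= 5].  Smaller degrees in [G] only decrease the form. *)
Lemma smallest_eigenvalue_join_lt (mu : R) :
  (5 <= s)%N -> (s <= #|G|)%N -> (max_degree G <= 2)%N ->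
  smallest_eigenvalue Q mu -> mu < s%:R - 1.
Proof.
move=> s5 st D2 mu_min; pose t : R := #|G|%:R.
pose a : R := - t; pose b : R := t - s%:R + 1.
pose y := vector_of (fun v : H => if v is inl _ then a else b).
have sum_left (e : R) : \sum_(i : edgeless s) e = s%:R * e.
  by rewrite sumr_const card_ord mulr_natl.
have sum_right (e : R) : \sum_(v : G) e = t * e.
  by rewrite sumr_const mulr_natl.
have y_left i : entry y (inl i : H) = a by rewrite entry_vector_of.
have y_right v : entry y (inr v : H) = b by rewrite entry_vector_of.
have normE : (y *m y^T) 0 0 = s%:R * (a * a) + t * (b * b).
  rewrite dot_entry sum_join -sum_left -sum_right.
  by congr (_ + _); apply: eq_bigr => v _; rewrite ?y_left ?y_right.
have form_le : (y *m Q *m y^T) 0 0 <=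
    s%:R * ((t * a + t * b) * a) + t * (((s%:R + 4) * b + s%:R * a) * b).
  rewrite dot_entry sum_join -!sum_left -!sum_right; apply: lerD.
    apply: ler_sum => i _; rewrite entry_join_left y_left sum_right.
    by under eq_bigr do rewrite y_right; rewrite sum_right.
  apply: ler_sum => v _; rewrite entry_join_right y_right.
  under eq_bigr do rewrite y_left.
  under [X in _ + (_ + X)]eq_bigr do rewrite y_right.
  rewrite sum_adj_cst.
  have dv : (degree v)%:R <= 2 :> R.
    by rewrite ler_nat (leq_trans (degree_le_max v)).
  have : (degree v)%:R * (b * b) <= 2 * (b * b).
    by rewrite ler_wpM2r // -expr2 sqr_ge0.
  by rewrite sum_left; move=> *; lra.
have rayleigh :=
  smallest_eigenvalue_rayleigh y (signless_laplacian_sym R H) mu_min.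
have := le_trans rayleigh form_le.
have s5R : 5 <= s%:R :> R by rewrite ler_nat.
have stR : s%:R <= t by rewrite ler_nat.
rewrite normE /a /b; move: (s%:R) s5R stR => s' s5R stR le_mu.
have t_gt0 : 0 < t by apply: lt_le_trans stR; lra.
rewrite ltNge; apply/negP => mu_ge.
have b_gt0 : 0 < t - s' + 1 by lra.
have N_ge0 : 0 <= s' * (- t * - t) + t * ((t - s' + 1) * (t - s' + 1)).
  by rewrite mulrNN addr_ge0 ?mulr_ge0 ?(ltW b_gt0) ?(ltW t_gt0) //; lra.
have := le_trans (ler_wpM2r N_ge0 mu_ge) le_mu; apply/negP; rewrite -ltNge -subr_gt0.
have -> : (s' - 1) * (s' * (- t * - t) + t * ((t - s' + 1) * (t - s' + 1))) -
    (s' * ((t * - t + t * (t - s' + 1)) * - t) +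
     t * (((s' + 4) * (t - s' + 1) + s' * - t) * (t - s' + 1))) =
    t * (s' * (s' - 1) * (t - s' + 1) + (s' - 5) * (t - s' + 1) ^+ 2) by ring.
rewrite mulr_gt0 // ltr_pwDl ?mulr_gt0 ?mulr_ge0 ?exprn_ge0 ?subr_ge0 //; lra.
Qed.

(** The equations at the vertices of [G] form the shifted system with
    [c = s - mu] and right-hand side [- A].  If [A = 0], then [B = 0] as
    [(t - mu) A = - s B], so the nonnegative solution is zero, and with it [x].
    If [A < 0], the solution is positive, so [B > 0] and each entry on the
    edgeless side, equal to [- B / (t - mu)], is negative. *)
Lemma eigenvector_join_sign (mu : R) (x : 'rV[R]_#|H|) :
  (0 < s)%N -> (s <= #|G|)%N -> mu < s%:R ->
  (max_degree G)%:R < s%:R - mu + 1 ->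
  x *m Q = mu *: x -> \sum_(i : edgeless s) entry x (inl i : H) <= 0 ->
  x = 0 \/ (forall i, entry x (inl i : H) < 0) /\
            (forall v, 0 < entry x (inr v : H)).
Proof.
move=> s_gt0 st mu_lt c_gt eig.
have entryZ v : entry (x *m Q) v = mu * entry x v by rewrite eig /entry mxE.
set A := \sum_(i : _) _ => A_le0; pose B := \sum_(v : G) entry x (inr v : H).
have stR : s%:R <= #|G|%:R :> R by rewrite ler_nat.
have t_mu : 0 < #|G|%:R - mu by lra.
have left_eq i : (#|G|%:R - mu) * entry x (inl i : H) = - B.
  by have := entryZ (inl i); rewrite entry_join_left -/B => ?; lra.
have right_eq v : (s%:R - mu + (degree v)%:R) * entry x (inr v : H) +
    \sum_(w : G | adj v w) entry x (inr w : H) = - A.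
  by have := entryZ (inr v); rewrite entry_join_right -/A => ?; lra.
have AB : (#|G|%:R - mu) * A = - (s%:R * B).
  rewrite mulr_sumr; under eq_bigr do rewrite left_eq.
  by rewrite sumr_const card_ord mulr_natl mulNrn.
have c_gt0 : 0 < s%:R - mu by lra.
have k_ge0 : 0 <= - A by rewrite oppr_ge0.
have sign := shifted_solution_sign c_gt c_gt0 k_ge0 right_eq.
have [A0|A_neq0] := eqVneq A 0.
  left; have B0 : B = 0.
    move/eqP: AB; rewrite A0 mulr0 eq_sym oppr_eq0 mulf_eq0 pnatr_eq0.
    by rewrite eqn0Ngt s_gt0 => /eqP.
  apply: entry_inj => -[i|v].
    move/eqP: (left_eq i); rewrite B0 oppr0 mulf_eq0 gt_eqF //.
    by move/eqP.
  apply: (psumr_eq0P _ B0) => // w _.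
  by have [/ltW|[_ ->]] := sign w.
right; have b_gt0 v : 0 < entry x (inr v : H).
  by have [//|[/eqP]] := sign v; rewrite oppr_eq0 (negbTE A_neq0).
have B_gt0 : 0 < B.
  have A_lt0 : A < 0 by rewrite lt_neqAle A_neq0.
  rewrite -(@pmulr_rgt0 _ s%:R) ?ltr0n // -oppr_lt0 -AB pmulr_rlt0 //.
split=> // i; rewrite -(@pmulr_rlt0 _ (#|G|%:R - mu)) // left_eq oppr_lt0 //.
Qed.

Lemma join_connected : (0 < s)%N -> (0 < #|G|)%N -> connected_graph H.
Proof.
move=> s_gt0 G_gt0; split; first by rewrite card_sum card_ord addn_gt0 s_gt0.
have /card_gt0P[v0 _] := G_gt0; pose i0 : edgeless s := Ordinal s_gt0.
move=> [i|v] [j|w].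
- by apply: (@connect_trans _ _ (inr v0)); apply: connect1.
- exact: connect1.
- exact: connect1.
- by apply: (@connect_trans _ _ (inl i0)); apply: connect1.
Qed.

Lemma mem_join_left_inl i : (inl i : H) \in join_left (edgeless s) G.
Proof. exact: imset_f. Qed.

Lemma mem_join_left_inr v : (inr v : H) \in join_left (edgeless s) G = false.
Proof. by apply/imsetP => -[]. Qed.

Lemma join_left_maximal_independent :
  (0 < s)%N -> maximal_independent (join_left (edgeless s) G).
Proof.
move=> s_gt0; apply/maxsetP; split.
  by apply/forall_inP => _ /imsetP[i _ ->]; apply/forall_inP => _ /imsetP[j _ ->].
move=> T /forall_inP indT sST; apply/eqP; rewrite eqEsubset sST andbT.
apply/subsetP => -[i|v] Tv; first exact: mem_join_left_inl.
have T0 : (inl (Ordinal s_gt0 : edgeless s) : H) \in T.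
  exact/(subsetP sST)/mem_join_left_inl.
by have /forall_inP/(_ _ T0) := indT _ Tv.
Qed.

End EdgelessJoin.

Theorem theorem12p1 (R : realType) (s t : nat) (G : sgraph) :
  (6 <= s)%N -> (s < t)%N -> #|G| = t -> (max_degree G <= 2)%N ->
  S_Roth R (join_left (edgeless s) G).
Proof.
move=> s6 st Gt D2.
have s_gt0 : (0 < s)%N by apply: leq_trans s6.
have sG : (s <= #|G|)%N by rewrite Gt ltnW.
split; first by apply: join_connected => //; apply: leq_trans sG.
  exact: join_left_maximal_independent.
move=> mu x mu_min [x_neq0 eig].
have mu_lt := smallest_eigenvalue_join_lt (ltnW s6) sG D2 mu_min.
have max_deg_lt : (max_degree G)%:R < s%:R - mu + 1.
  by apply: (@le_lt_trans _ _ 2); [rewrite ler_nat | lra].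
have mu_lt_s : mu < s%:R by lra.
have sign y := @eigenvector_join_sign R s G mu y s_gt0 sG mu_lt_s max_deg_lt.
have [A_le0|A_gt0] := lerP (\sum_(i : edgeless s) entry x (inl i : join _ G)) 0.
  right; have [x0|[neg pos]] := sign x eig A_le0; first by rewrite x0 eqxx in x_neq0.
  by split=> -[i|v]; rewrite ?inE ?mem_join_left_inl ?mem_join_left_inr.
have entryN v : entry (- x) v = - entry x v by rewrite /entry mxE.
left; have [||x0|[neg pos]] := sign (- x).
- by rewrite mulNmx eig scalerN.
- by under eq_bigr do rewrite entryN; rewrite sumrN oppr_le0 ltW.
- by rewrite -oppr_eq0 x0 eqxx in x_neq0.
split=> -[i|v]; rewrite ?inE ?mem_join_left_inl ?mem_join_left_inr // => _.
  by have := neg i; rewrite entryN oppr_lt0.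
by have := pos v; rewrite entryN oppr_gt0.
Qed.
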